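(* Let $M$ be an oriented surface in Euclidean 3-space $E^3$ with unit normal field, and let $\alpha=\alpha(s)$ be a curve on $M$ parametrized by arc length $s$, with nowhere vanishing curvature, Frenet frame $\{T,N,B\}$ and Darboux frame $\{T,g,n\}$. Let $\theta=\theta(s)$ be the angle between $g$ and $N$, in the sense that $$g=\cos\theta\, N+\sin\theta\, B,\qquad n=-\sin\theta\, N+\cos\theta\, B .$$ Let the spinors $\psi=\psi(s)$ and $\phi=\phi(s)$ represent the triads $\{N,B,T\}$ and $\{g,n,T\}$ respectively, i.e. $$N+iB=\psi^t\sigma\psi,\quad T=-\hat{\psi}^t\sigma\psi,\quad \bar{\psi}^t\psi=1,\qquad\qquad g+in=\phi^t\sigma\phi,\quad T=-\hat{\phi}^t\sigma\phi,\quad \bar{\phi}^t\phi=1 .$$ Then the spinor formulations of the Frenet frame and the Darboux frame are related by $$\psi^t\sigma\psi=e^{i\theta}\,(\phi^t\sigma\phi),$$ with the tangent vector $T$ being the same in both, i.e. $-\hat{\psi}^t\sigma\psi=T=-\hat{\phi}^t\sigma\phi$.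
   Context: Spinors: a spinor is a column vector $\psi=\begin{pmatrix}\psi_1\\ \psi_2\end{pmatrix}\in\mathbb{C}^2$; $t$ denotes transposition, a bar denotes complex conjugation, and the mate of $\psi$ is $\hat{\psi}=\begin{pmatrix}-\bar{\psi}_2\\ \bar{\psi}_1\end{pmatrix}$. The symbol $\sigma=(\sigma_1,\sigma_2,\sigma_3)$ is the vector of complex symmetric matrices $$\sigma_1=\begin{pmatrix}1&0\\0&-1\end{pmatrix},\quad \sigma_2=\begin{pmatrix}i&0\\0&i\end{pmatrix},\quad \sigma_3=\begin{pmatrix}0&-1\\-1&0\end{pmatrix},$$ and for spinors $\phi,\psi$ the expression $\phi^t\sigma\psi\in\mathbb{C}^3$ is the vector with components $\phi^t\sigma_k\psi$, $k=1,2,3$. A spinor representing a given positively oriented orthonormal triad exists and is unique up to sign. Frames: for a unit speed curve $\alpha$ on the oriented surface $M$, $T=\alpha'$ is the unit tangent, $N=T'/\|T'\|$ the principal normal and $B=T\wedge N$ the binormal (Frenet frame); $n$ is the unit normal of $M$ along $\alpha$ and $g=n\wedge T$ (cross product), giving the Darboux frame $\{T,g,n\}$. Since $T$ is common to both frames, $N,B,g,n$ all lie in the plane orthogonal to $T$, and the two frames differ by a rotation through the angle $\theta$ in that plane. *)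

(* Defs.v *)
From mathcomp Require Import all_boot all_order all_algebra.
From mathcomp Require Import complex.
From mathcomp Require Import all_classical all_reals all_analysis.
Import Order.TTheory GRing.Theory Num.Theory.
Import numFieldNormedType.Exports.

Set Implicit Arguments.
Unset Strict Implicit.
Unset Printing Implicit Defensive.

Local Open Scope classical_set_scope.
Local Open Scope ring_scope.

Section Euclidean.
Variable R : realType.

(* The library norm `|u| on row vectors is the sup norm; it induces the usual
   topology, but lengths must be measured with [enorm]. *)
Definition dot (u v : 'rV[R]_3) : R := (u *m v^T) 0 0.
Definition enorm (u : 'rV[R]_3) : R := Num.sqrt (dot u u).

Definition rvec3 (x y z : R) : 'rV[R]_3 := \row_(j < 3) [:: x; y; z]`_j.

Definition cross (u v : 'rV[R]_3) : 'rV[R]_3 :=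
  let u1 := u 0 (inord 0) in let u2 := u 0 (inord 1) in let u3 := u 0 (inord 2) in
  let v1 := v 0 (inord 0) in let v2 := v 0 (inord 1) in let v3 := v 0 (inord 2) in
  rvec3 (u2 * v3 - u3 * v2) (u3 * v1 - u1 * v3) (u1 * v2 - u2 * v1).

End Euclidean.

Section Smooth.
Variables (R : realType) (V W : normedModType R).

Definition iter_dderive (vs : seq V) (f : V -> W) : V -> W :=
  foldr (fun v g => 'D_v g) f vs.

(* C^oo on U: every iterated directional derivative is (Frechet)
   differentiable at every point of U. Meant for open U. *)
Definition smooth_on (U : set V) (f : V -> W) : Prop :=
  forall (vs : seq V) (x : V), U x -> differentiable (iter_dderive vs f) x.

End Smooth.

Section Surfaces.
Variable R : realType.

(* x : U -> V `&` M is a regular parametrization: smooth, with injective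
   differential, and a homeomorphism onto V `&` M with inverse y. *)
Definition regular_chart (M : set 'rV[R]_3) (U : set 'rV[R]_2)
    (V : set 'rV[R]_3) (x : 'rV[R]_2 -> 'rV[R]_3) : Prop :=
  [/\ smooth_on U x,
      x @` U = V `&` M,
      exists y : 'rV[R]_3 -> 'rV[R]_2,
        (forall q, U q -> y (x q) = q) /\ {within V `&` M, continuous y}
    & forall q, U q -> injective ('d x q : 'rV[R]_2 -> 'rV[R]_3)].

Definition regular_surface (M : set 'rV[R]_3) : Prop :=
  forall p, M p -> exists U V x,
    [/\ open U, open V, V p & regular_chart M U V x].

Definition tangent_vector (M : set 'rV[R]_3) (p v : 'rV[R]_3) : Prop :=
  exists (e : R) (c : R -> 'rV[R]_3),
    [/\ 0 < e, smooth_on (V := R^o) [set` `]-e, e[] c,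
        forall t, t \in `]-e, e[ -> M (c t), c 0 = p & derive1 c 0 = v].

(* A continuous unit normal field, i.e. an orientation of M; only the values
   of nu on M matter. *)
Definition unit_normal_field (M : set 'rV[R]_3) (nu : 'rV[R]_3 -> 'rV[R]_3) :
    Prop :=
  [/\ {within M, continuous nu},
      forall p, M p -> enorm (nu p) = 1
    & forall p v, M p -> tangent_vector M p v -> dot (nu p) v = 0].

Definition oriented_surface (M : set 'rV[R]_3) (nu : 'rV[R]_3 -> 'rV[R]_3) :
    Prop :=
  regular_surface M /\ unit_normal_field M nu.

End Surfaces.

Section Curves.
Variable R : realType.
Implicit Type alpha : R -> 'rV[R]_3.

Definition unit_speed_curve_on (M : set 'rV[R]_3) (J : set R) alpha : Prop :=
  [/\ open J, is_interval J, smooth_on (V := R^o) J alpha,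
      forall s, J s -> M (alpha s)
    & forall s, J s -> enorm (derive1 alpha s) = 1].

Definition tangent alpha : R -> 'rV[R]_3 := derive1 alpha.

Definition curvature alpha (s : R) : R := enorm (derive1 (tangent alpha) s).

Definition principal_normal alpha (s : R) : 'rV[R]_3 :=
  (curvature alpha s)^-1 *: derive1 (tangent alpha) s.

Definition binormal alpha (s : R) : 'rV[R]_3 :=
  cross (tangent alpha s) (principal_normal alpha s).

Definition darboux_normal (nu : 'rV[R]_3 -> 'rV[R]_3) alpha (s : R) :
    'rV[R]_3 := nu (alpha s).

Definition darboux_conormal (nu : 'rV[R]_3 -> 'rV[R]_3) alpha (s : R) :
    'rV[R]_3 := cross (darboux_normal nu alpha s) (tangent alpha s).

End Curves.

Section Spinors.
Variable R : realType.
Local Notation C := R[i].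

Definition cexp (z : C) : C :=
  let: (x +i* y)%C := z in (expR x)%:C%C * (cos y +i* sin y)%C.

Definition mx2 (a b c d : C) : 'M[C]_2 :=
  \matrix_(i < 2, j < 2) (nth [::] [:: [:: a; b]; [:: c; d]] i)`_j.

Definition sigma (k : 'I_3) : 'M[C]_2 :=
  nth 0 [:: mx2 1 0 0 (-1); mx2 ('i)%C 0 0 ('i)%C; mx2 0 (-1) (-1) 0] k.

Definition conj_spinor (psi : 'cV[C]_2) : 'cV[C]_2 := map_mx (@conjc R) psi.

Definition mate (psi : 'cV[C]_2) : 'cV[C]_2 :=
  \col_(i < 2) [:: - (psi (inord 1) 0)^*%C; (psi (inord 0) 0)^*%C]`_i.

(* phi^t sigma psi *)
Definition sigma_form (phi psi : 'cV[C]_2) : 'rV[C]_3 :=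
  \row_(k < 3) (phi^T *m sigma k *m psi) 0 0.

Definition complexify (u : 'rV[R]_3) : 'rV[C]_3 := map_mx (real_complex R) u.

(* psi represents the ordered triad {a, b, c} *)
Definition represents (psi : 'cV[C]_2) (a b c : 'rV[R]_3) : Prop :=
  [/\ complexify a + ('i)%C *: complexify b = sigma_form psi psi,
      complexify c = - sigma_form (mate psi) psi
    & (conj_spinor psi)^T *m psi = 1%:M].

End Spinors.

(* Main.v *)
(* Both frames contain T, so {N, B} is a rotation of {g, n} in the plane
   orthogonal to T, and such a rotation multiplies the isotropic vector g + in
   by a phase: N + iB = e^{i theta} (g + in). *)
Require Import Defs.
From mathcomp Require Import all_boot all_order all_algebra.
From mathcomp Require Import complex.
From mathcomp Require Import all_classical all_reals all_analysis.
From mathcomp Require Import ring.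
Import Order.TTheory GRing.Theory Num.Theory.
Import numFieldNormedType.Exports.

Local Open Scope classical_set_scope.
Local Open Scope ring_scope.

Lemma cexp_im (R : realType) (t : R) :
  cexp (('i)%C * t%:C%C) = (cos t +i* sin t)%C.
Proof.
rewrite /cexp; simpc.
by rewrite expR0 !mul1r.
Qed.

(** Since [sin t + i cos t = i (cos t - i sin t)], collecting terms gives
    [g + in = e^{-it} (N + iB)]; multiplying by [e^{it}] undoes the phase. *)
Lemma complex_frame_rotation (R : realType) (t : R) (N B g n : 'rV[R]_3) :
  g = cos t *: N + sin t *: B -> n = - sin t *: N + cos t *: B ->
  complexify N + ('i)%C *: complexify B =
    cexp (('i)%C * t%:C%C) *: (complexify g + ('i)%C *: complexify n).
Proof.
move=> -> ->; rewrite cexp_im; apply/rowP => k; rewrite !mxE; simpc.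
(* Real and imaginary parts agree only modulo [cos^2 + sin^2 = 1], which [ring] does not know;
   scaling the left side by this sum makes each a polynomial identity. *)
by congr (_ +i* _)%C; rewrite -[LHS]mul1r -(cos2Dsin2 t); ring.
Qed.

Theorem theorem3p2 (R : realType)
  (M : set 'rV[R]_3) (nu : 'rV[R]_3 -> 'rV[R]_3)
  (J : set R) (alpha : R -> 'rV[R]_3)
  (theta : R -> R) (psi phi : R -> 'cV[R[i]]_2) :
  let T := tangent alpha in
  let N := principal_normal alpha in
  let B := binormal alpha in
  let g := darboux_conormal nu alpha in
  let n := darboux_normal nu alpha in
  oriented_surface M nu ->
  unit_speed_curve_on M J alpha ->
  (forall s, J s -> curvature alpha s != 0) ->
  (forall s, J s -> g s = cos (theta s) *: N s + sin (theta s) *: B s) ->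
  (forall s, J s -> n s = - sin (theta s) *: N s + cos (theta s) *: B s) ->
  (forall s, J s -> represents (psi s) (N s) (B s) (T s)) ->
  (forall s, J s -> represents (phi s) (g s) (n s) (T s)) ->
  forall s, J s ->
    [/\ sigma_form (psi s) (psi s) =
          cexp (('i)%C * (theta s)%:C%C) *: sigma_form (phi s) (phi s),
        - sigma_form (mate (psi s)) (psi s) = complexify (T s)
      & complexify (T s) = - sigma_form (mate (phi s)) (phi s)].
Proof.
move=> T N B g n _ _ _ gE nE psiE phiE s Js.
have [psiNB psiT _] := psiE s Js; have [phigN phiT _] := phiE s Js.
split; [|exact/esym|by []].
(* Reading both quadratic forms back as [N + iB] and [g + in] removes the spinors and leaves a
   pointwise identity between frames. *)
by rewrite -psiNB -phigN; apply: complex_frame_rotation; [exact: gE|exact: nE].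
Qed.
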